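(* Let $D\subseteq[n]^2$ and $\alpha=(\alpha_1,\dots,\alpha_n)\in\mathbb{Z}^n$ with $\alpha_1+\dots+\alpha_n=\#D$. Then $\mathcal{P}(D,\alpha)\cap\mathbb{Z}^{n^2}\neq\emptyset$ if and only if $\mathcal{P}(D,\alpha)\neq\emptyset$.
   Context: For $D\subseteq[n]^2$ and $\alpha=(\alpha_1,\dots,\alpha_n)$, $\mathcal{P}(D,\alpha)\subseteq\mathbb{R}^{n^2}$ (the indicator polytope) is the set of points $(\alpha_{ij})_{i,j\in[n]}$ satisfying: (A) for all $i,j\in[n]$: $0\le\alpha_{ij}\le1$; (B) for all $i\in[n]$: $\sum_{j=1}^n\alpha_{ij}=\alpha_i$; (C) for all $s,j\in[n]$: $\sum_{i=1}^s\alpha_{ij}\ge\#\{i\in[n]:(i,j)\in D,\ i\le s\}$. *)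

(* Defs.v *)
From HB Require Import structures.
From mathcomp Require Import all_boot all_order all_algebra.
From mathcomp Require Import classical_sets reals.

Set Implicit Arguments.
Unset Strict Implicit.
Unset Printing Implicit Defensive.

Import Order.TTheory GRing.Theory Num.Theory.
Local Open Scope classical_set_scope.
Local Open Scope ring_scope.

(* [n] is represented by 'I_n, so all indices are shifted by one;
   R^(n^2) is 'M[R]_n, the coordinate alpha_ij being the entry A i j. *)
Definition indicator_polytope (R : realType) (n : nat)
    (D : {set 'I_n * 'I_n}) (alpha : 'rV[R]_n) : set 'M[R]_n :=
  [set A : 'M[R]_n |
    [/\ forall i j : 'I_n, 0 <= A i j <= 1,
        forall i : 'I_n, \sum_(j < n) A i j = alpha 0 i
      & forall s j : 'I_n,
          \sum_(i < n | (i <= s)%N) A i j >=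
          #|[set i : 'I_n | ((i, j) \in D) && (i <= s)%N]%SET|%:R]].

Definition integer_points (R : realType) (n : nat) : set 'M[R]_n :=
  [set A : 'M[R]_n | forall i j : 'I_n, A i j \is a Num.int].

(* Main.v *)
(* The points of the polytope are flows in a network whose arcs carry the
   entries and the column prefix sums, subject to integral bounds.  If some
   entry is fractional, then every row meets the fractional entries zero or at
   least two times, and so does every group of fractional entries of a column
   sharing the same next integral prefix sum (the entries, in all columns,
   followed by no integral prefix sum form one more group, because the total is
   integral).  Hence the fractional entries carry a nonzero perturbation
   preserving all row sums and all integral arcs; following it until some
   further arc becomes integral never crosses an integral bound, so iterating
   ends at an integral point. *)
Require Import Defs.
From HB Require Import structures.
From mathcomp Require Import all_boot all_order all_algebra.
From mathcomp Require Import classical_sets reals.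

Set Implicit Arguments.
Unset Strict Implicit.
Unset Printing Implicit Defensive.

Import Order.TTheory GRing.Theory Num.Theory.
Local Open Scope classical_set_scope.
Local Open Scope ring_scope.

(** * Linear algebra and circulations on bipartite multigraphs *)

(** The coefficient matrix has more rows than columns, so its left kernel contains a nonzero vector;
    [b] is that vector extended by zero outside [E]. *)
Lemma exists_solution_underdetermined (K : fieldType) (T L : finType)
    (E : {set T}) (S : {set L}) (a : T -> L -> K) :
  (#|S| < #|E|)%N ->
  exists b : T -> K,
    [/\ exists e, b e != 0,
        forall e, e \notin E -> b e = 0
      & forall l, l \in S -> \sum_(e in E) b e * a e l = 0].
Proof.
move=> ltSE.
pose M := \matrix_(i < #|E|, l < #|S|) a (enum_val i) (enum_val l).
have : kermx M != 0.
  rewrite kermx_eq0 /row_free neq_ltn.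
  by rewrite (leq_ltn_trans (rank_leq_col M) ltSE).
case/rowV0Pn => u /sub_kermxP uM0 u_neq0.
pose b e := \sum_(i < #|E|) u 0 i * (enum_val i == e)%:R.
have b_val i : b (enum_val i) = u 0 i.
  rewrite /b (bigD1 i) //= eqxx mulr1 big1 ?addr0 // => k neq_ki.
  by rewrite (inj_eq enum_val_inj) (negPf neq_ki) mulr0.
exists b; split.
- case/rV0Pn: u_neq0 => i ui_neq0.
  by exists (enum_val i); rewrite b_val.
- move=> e eNE; rewrite /b big1 // => i _.
  case: eqP => [ie|_]; last by rewrite mulr0.
  by rewrite -ie enum_valP in eNE.
move=> l Sl; rewrite big_enum_val /=.
move/rowP/(_ (enum_rank_in Sl l)): uM0; rewrite !mxE => uMl.
by rewrite -[RHS]uMl; apply: eq_bigr => i _; rewrite mxE b_val enum_rankK_in.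
Qed.

Lemma leq_card_imset_double (T U : finType) (E : {set T}) (p : T -> U) :
  (forall e, e \in E -> exists2 e', e' \in E & (e' != e) && (p e' == p e)) ->
  (#|p @: E|.*2 <= #|E|)%N.
Proof.
move=> partner; rewrite -[leqRHS]sum1_card (partition_big_imset p) /=.
rewrite -muln2 -sum_nat_const; apply: leq_sum => x /imsetP[e Ee ->].
have [e' Ee' /andP[neq_e'e /eqP eq_p]] := partner e Ee.
rewrite (bigD1 e) ?Ee ?eqxx //= (bigD1 e') //=.
by rewrite Ee' eq_p eqxx neq_e'e.
Qed.

(* View E as the edges of a bipartite multigraph with endpoint maps p and q.
   Minimum degree 2 gives at least as many edges as vertices; one vertex
   equation follows from the others, so the equations are underdetermined. *)
Lemma exists_circulation (K : fieldType) (T P Q : finType) (E : {set T})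
    (p : T -> P) (q : T -> Q) :
  E != finset.set0 ->
  (forall e, e \in E -> exists2 e', e' \in E & (e' != e) && (p e' == p e)) ->
  (forall e, e \in E -> exists2 e', e' \in E & (e' != e) && (q e' == q e)) ->
  exists b : T -> K,
    [/\ exists e, b e != 0,
        forall e, e \notin E -> b e = 0,
        forall x, \sum_(e | p e == x) b e = 0
      & forall y, \sum_(e | q e == y) b e = 0].
Proof.
case/set0Pn => e0 Ee0 partner_p partner_q.
pose Sp := p @: E; pose Sq := (q @: E) :\ q e0.
pose S : {set P + Q} := (inl @: Sp :|: inr @: Sq)%SET.
pose a e (l : P + Q) : K :=
  match l with inl x => (p e == x)%:R | inr y => (q e == y)%:R end.
have ltSE : (#|S| < #|E|)%N.
  apply: leq_ltn_trans (leq_card_setU _ _) _.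
  rewrite (card_imset Sp (@inl_inj P Q)) (card_imset Sq (@inr_inj P Q)).
  have := leq_card_imset_double partner_p.
  have := leq_card_imset_double partner_q.
  rewrite (cardsD1 (q e0) (q @: E)) imset_f //= -/Sp -/Sq => cardq cardp.
  rewrite -ltn_double doubleD -[X in (_ < X)%N]addnn.
  apply: leq_trans (leq_add cardp cardq).
  by rewrite add1n doubleS !addnS ltnS leqnSn.
have [b [b_neq0 bNE bS]] := exists_solution_underdetermined a ltSE.
have sumE (D : pred T) : \sum_(e | D e) b e = \sum_(e in E) b e * (D e)%:R.
  rewrite [RHS]big_mkcond [LHS]big_mkcond; apply: eq_bigr => e _.
  case: ifP => De; case: ifPn => Ee; rewrite ?mulr1 ?mulr0 //.
  exact: bNE.
have sum_p x : \sum_(e | p e == x) b e = 0.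
  rewrite sumE; case: (boolP (x \in Sp)) => [Spx|Spx].
    by apply: (bS (inl x)); rewrite inE imset_f.
  rewrite big1 // => e Ee; case: eqP => [ex|_]; last by rewrite mulr0.
  by rewrite -ex imset_f in Spx.
have sum_q' y : y != q e0 -> \sum_(e | q e == y) b e = 0.
  move=> neq_y; rewrite sumE; case: (boolP (y \in Sq)) => [Sqy|].
    by apply: (bS (inr y)); rewrite inE [X in _ || X]imset_f ?orbT.
  rewrite !inE neq_y /= => Sqy.
  rewrite big1 // => e Ee; case: eqP => [ey|_]; last by rewrite mulr0.
  by rewrite -ey imset_f in Sqy.
exists b; split=> // y; have [->|] := eqVneq y (q e0); last exact: sum_q'.
(* The equation left out of [S]: the total of [b] vanishes by grouping along [p], and every other
   class of [q] contributes zero. *)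
have : \sum_e b e = 0.
  by rewrite (partition_big p predT) //= big1 // => x _; apply: sum_p.
rewrite (partition_big q predT) //= (bigD1 (q e0)) //=.
by rewrite [X in _ + X]big1 ?addr0 // => z; apply: sum_q'.
Qed.

(** * Fractional values and a single rounding step *)

Lemma nonint_partner (R : archiNumDomainType) (I : finType) (P : pred I)
    (f : I -> R) (i : I) :
  \sum_(k | P k) f k \is a Num.int -> P i -> f i \isn't a Num.int ->
  exists2 k, f k \isn't a Num.int & (k != i) && P k.
Proof.
move=> sum_int Pi fi.
case: (pickP [pred k | (f k \isn't a Num.int) && ((k != i) && P k)]) => [k|no].
  by case/andP=> fk ?; exists k.
case/negP: fi; rewrite (bigD1 i) //= in sum_int.
suff rest : \sum_(k | P k && (k != i)) f k \is a Num.int.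
  by rewrite -[f i](addrK (\sum_(k | P k && (k != i)) f k)) rpredB.
apply: rpred_sum => k /andP[Pk neq_ki].
by apply: contraFT (no k) => fk; rewrite /= fk neq_ki Pk.
Qed.

(** Moving from [f] along [b], coordinate [i] first meets an integer [z i] at time [d i]. Stopping
    at the least such time crosses no integer, and the minimizing coordinate lands on one. *)
Lemma exists_rounding_step (R : archiRealFieldType) (I : finType)
    (f b : I -> R) :
  (forall i, f i \is a Num.int -> b i = 0) -> (exists i, b i != 0) ->
  exists t : R,
    (forall i (m : int), (m%:~R <= f i -> m%:~R <= f i + t * b i) /\
                         (f i <= m%:~R -> f i + t * b i <= m%:~R)) /\
    (exists2 i, f i \isn't a Num.int & f i + t * b i \is a Num.int).
Proof.
move=> b_int [i0 bi0].
pose z i : int := if 0 < b i then Num.ceil (f i) else Num.floor (f i).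
pose d i := ((z i)%:~R - f i) / b i.
have d_ge0 i : 0 <= d i.
  rewrite /d /z; case: ltP => bi.
    by rewrite divr_ge0 ?subr_ge0 ?ceil_ge ?(ltW bi).
  by rewrite mulr_le0 ?invr_le0 // subr_le0 floor_le.
(* Where [b i = 0], division by zero makes [d i] equal to 0, so such indices must be kept out of the
   minimum. *)
pose i1 := [arg min_(i < i0 | b i != 0) d i]%O.
have [bi1 d_min] : b i1 != 0 /\ forall i, b i != 0 -> d i1 <= d i.
  by rewrite /i1; case: arg_minP.
exists (d i1); split.
  move=> i m; have [bi|bi|->] := ltgtP (b i) 0; last by rewrite mulr0 addr0.
  - have le_d := d_min i (ltr0_neq0 bi); split=> fm; last first.
      by rewrite -[leRHS]addr0 lerD // mulr_ge0_le0 ?(ltW bi).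
    apply: le_trans (_ : (z i)%:~R <= _); last first.
      by rewrite -lerBlDl -ler_ndivlMr.
    by rewrite ler_int /z ltNge (ltW bi) /= floor_ge_int.
  - have le_d := d_min i (lt0r_neq0 bi); split=> fm.
      by rewrite -[leLHS]addr0 lerD // mulr_ge0 ?(ltW bi).
    apply: le_trans (_ : _ <= (z i)%:~R) _.
      by rewrite -lerBrDl -ler_pdivlMr.
    by rewrite ler_int /z bi ceil_le_int.
exists i1; first by apply: contra bi1 => /b_int ->.
by rewrite /d mulfVK // addrC subrK intr_int.
Qed.

(** * Column prefixes and the classes they cut out *)

Definition column_le n (e k : 'I_n * 'I_n) : bool :=
  (e.2 == k.2) && (e.1 <= k.1)%N.

(* [None] is the label of the entries followed by no integral prefix sum. *)
Definition option_column_le n (y : option ('I_n * 'I_n)) (k : 'I_n * 'I_n) :=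
  if y is Some k' then column_le k' k else false.

(** [q e] is the first position of [K] reached when going down the column from [e], with [e] itself
    allowed. Hence a prefix ending in [K] is a union of whole classes of [q]. *)
Lemma exists_next_in_column n (K : {set 'I_n * 'I_n}) :
  exists q : 'I_n * 'I_n -> option ('I_n * 'I_n),
    (forall e k, q e = Some k -> k \in K) /\
    (forall e k, k \in K -> option_column_le (q e) k = column_le e k).
Proof.
pose above e : pred ('I_n * 'I_n) := [pred k | (k \in K) && column_le e k].
pose q e := if [pick k | above e k] is Some k0
            then Some [arg min_(k < k0 | above e k) (k.1 : nat)]%N else None.
exists q; split=> e k; rewrite /q.
  by case: pickP => // k0 ek0 [<-]; case: arg_minnP => // k' /andP[].
move=> Kk; case: pickP => [k0 ek0|no] /=; last first.
  by rewrite -(no k) /above /= Kk.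
case: arg_minnP => // k' /andP[_ /andP[/eqP ek' le_ek']] min_k'.
apply/idP/idP=> [/andP[/eqP k'k le_k'k]|/[dup] /andP[/eqP ek _] le_ek].
  by rewrite /column_le ek' k'k eqxx (leq_trans le_ek').
by rewrite /column_le -ek' ek eqxx min_k' // /above /= Kk.
Qed.

Section ColumnClasses.

Variables (n : nat) (K : {set 'I_n * 'I_n}).
Variable q : 'I_n * 'I_n -> option ('I_n * 'I_n).
Hypothesis qK : forall e k, q e = Some k -> k \in K.
Hypothesis q_le :
  forall e k, k \in K -> option_column_le (q e) k = column_le e k.

Lemma sum_column_classes (V : nmodType) (f : 'I_n * 'I_n -> V) k : k \in K ->
  \sum_(e | column_le e k) f e =
  \sum_(y | option_column_le y k) \sum_(e | q e == y) f e.
Proof.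
move=> Kk.
rewrite (partition_big q (fun y => option_column_le y k)) => [|e]; last first.
  by rewrite q_le.
apply: eq_bigr => y yk; apply: eq_bigl => e.
by case: eqP => [qe|]; rewrite ?andbF // -q_le // qe yk.
Qed.

Lemma class_sum_int (R : archiNumDomainType) (f : 'I_n * 'I_n -> R) :
  (forall k, k \in K -> \sum_(e | column_le e k) f e \is a Num.int) ->
  \sum_e f e \is a Num.int ->
  forall y, \sum_(e | q e == y) f e \is a Num.int.
Proof.
move=> prefix_int total_int.
have cancel_int (u v : R) :
    u + v \is a Num.int -> v \is a Num.int -> u \is a Num.int.
  by move=> uv_int v_int; rewrite -[u](addrK v) rpredB.
have some_int k : \sum_(e | q e == Some k) f e \is a Num.int.
  (* Strong induction on the row of [k]: the other classes in the prefix ending at [k] have labels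
     in strictly smaller rows, so their integral sums can be subtracted. *)
  have [m] := ubnP (k.1 : nat); elim: m k => // m IHm k ltkm.
  case: (boolP (k \in K)) => [Kk|KNk]; last first.
    by rewrite big_pred0 // => e; apply: contraNF KNk => /eqP/qK.
  have := prefix_int k Kk; rewrite sum_column_classes //.
  rewrite (bigD1 (Some k)) /=; last by rewrite /column_le eqxx leqnn.
  move/cancel_int; apply; apply: rpred_sum => -[k'|] //= /andP[le_k'k neq_k'k].
  apply: IHm; apply: leq_trans (ltnSE ltkm).
  case/andP: le_k'k => /eqP k'2 le_k'1.
  rewrite ltn_neqAle le_k'1 andbT; apply: contraNN neq_k'k => /eqP k'1.
  by rewrite [k']surjective_pairing [k]surjective_pairing k'2 (val_inj k'1).
case=> //; move: total_int.
rewrite (partition_big q predT) //= (bigD1 None) //=.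
by move/cancel_int; apply; apply: rpred_sum => -[k|].
Qed.

End ColumnClasses.

(* [inl e] is the single entry [e], [inr (s, j)] the entries of column [j] in
   rows up to and including [s]. *)
Definition cut n (g : ('I_n * 'I_n) + ('I_n * 'I_n)) : pred ('I_n * 'I_n) :=
  match g with inl e => pred1 e | inr k => [pred e | column_le e k] end.

(** Rows and classes of [q] both have integral sums, so no fractional entry is alone in either, and
    a circulation on the fractional entries exists. It vanishes on each class, hence on each
    integral prefix. *)
Lemma cut_circulation (R : archiNumFieldType) n (x : 'I_n * 'I_n -> R) :
  (forall i, \sum_(e | e.1 == i) x e \is a Num.int) ->
  (exists e, x e \isn't a Num.int) ->
  exists b : 'I_n * 'I_n -> R,
    [/\ exists e, b e != 0,
        forall i, \sum_(e | e.1 == i) b e = 0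
      & forall g, \sum_(e | cut g e) x e \is a Num.int ->
          \sum_(e | cut g e) b e = 0].
Proof.
move=> row_int [e0 xe0].
pose E := [set e | x e \isn't a Num.int]%SET.
pose K := [set k | \sum_(e | column_le e k) x e \is a Num.int]%SET.
have [q [qK q_le]] := exists_next_in_column K.
have class_int : forall y, \sum_(e | q e == y) x e \is a Num.int.
  apply: (class_sum_int qK q_le) => [k|]; first by rewrite inE.
  by rewrite (partition_big fst predT) //=; apply: rpred_sum.
have E_neq0 : E != finset.set0 by apply/set0Pn; exists e0; rewrite inE.
have partner (U : finType) (p : 'I_n * 'I_n -> U) :
    (forall u, \sum_(e | p e == u) x e \is a Num.int) ->
    forall e, e \in E -> exists2 e', e' \in E & (e' != e) && (p e' == p e).
  move=> p_int e; rewrite inE => xe.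
  have [e' xe' e'P] := nonint_partner (p_int (p e)) (eqxx _) xe.
  by exists e'; rewrite ?inE.
have [b [b_neq0 bNE row_b class_b]] :=
  exists_circulation R E_neq0 (partner _ _ row_int) (partner _ _ class_int).
exists b; split=> // -[e|k] /= sum_int.
  by rewrite !big_pred1_eq in sum_int *; apply: bNE; rewrite inE negbK.
by rewrite (sum_column_classes q_le) ?inE // big1.
Qed.

(** * Iterated rounding and the theorem *)

(** Induction on the number of fractional cuts. Prefix cuts are counted too, since a step may make
    only a prefix sum integral. Bounds by arbitrary integers [m] compose from step to step. *)
Lemma exists_integral_rounding (R : archiRealFieldType) n
    (x : 'I_n * 'I_n -> R) :
  (forall i, \sum_(e | e.1 == i) x e \is a Num.int) ->
  exists y : 'I_n * 'I_n -> R,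
    [/\ forall e, y e \is a Num.int,
        forall i, \sum_(e | e.1 == i) y e = \sum_(e | e.1 == i) x e
      & forall g (m : int),
          (m%:~R <= \sum_(e | cut g e) x e ->
           m%:~R <= \sum_(e | cut g e) y e) /\
          (\sum_(e | cut g e) x e <= m%:~R ->
           \sum_(e | cut g e) y e <= m%:~R)].
Proof.
have [N] := ubnP #|[set g | \sum_(e | cut g e) x e \isn't a Num.int]%SET|.
elim: N x => // N IHN x ltN row_int.
case: (pickP [pred e | x e \isn't a Num.int]) => [e0 xe0|all_int]; last first.
  by exists x; split=> // e; apply/negbFE/all_int.
have [b [[e1 be1] row_b cut_b]] := cut_circulation row_int (ex_intro _ e0 xe0).
have := exists_rounding_step cut_b.
case; first by exists (inl e1); rewrite /= big_pred1_eq.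
move=> t [x'_bounds [g1 xg1 x'g1]].
pose x' e := x e + t * b e.
have sum_x' P :
    \sum_(e | P e) x' e = \sum_(e | P e) x e + t * \sum_(e | P e) b e.
  by rewrite big_split /= mulr_sumr.
have row_x' i : \sum_(e | e.1 == i) x' e = \sum_(e | e.1 == i) x e.
  by rewrite sum_x' row_b mulr0 addr0.
have [||y [y_int row_y y_bounds]] := IHN x'.
- apply: leq_trans (ltnSE ltN); apply/proper_card/properP; split.
    apply/fintype.subsetP => g; rewrite !inE sum_x'; apply: contraNN => xg.
    by rewrite cut_b // mulr0 addr0.
  by exists g1; rewrite inE // sum_x' negbK.
- by move=> i; rewrite row_x'.
exists y; split=> // [i|g m]; first by rewrite row_y.
have [le_x' ge_x'] := x'_bounds g m; have [le_y ge_y] := y_bounds g m.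
by rewrite sum_x' in le_y ge_y; split=> [/le_x'/le_y|/ge_x'/ge_y].
Qed.

Theorem theorem2p27 (R : realType) (n : nat) (D : {set 'I_n * 'I_n})
    (alpha : 'rV[int]_n) (sum_alpha : \sum_(i < n) alpha 0 i = #|D|%:Z) :
  (indicator_polytope D (map_mx intr alpha : 'rV[R]_n)
     `&` @integer_points R n) !=set0 <->
  indicator_polytope D (map_mx intr alpha : 'rV[R]_n) !=set0.
Proof.
split=> [[A [PA _]]|[A [A01 A_row A_prefix]]]; first by exists A.
have row_sum (f : 'I_n * 'I_n -> R) i :
    \sum_(e | e.1 == i) f e = \sum_j f (i, j).
  transitivity (\sum_(k | k == i) \sum_j f (k, j)); last exact: big_pred1_eq.
  by rewrite pair_big; apply: eq_big => [e|[]] //=; rewrite andbT.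
have column_sum (f : 'I_n * 'I_n -> R) s j :
    \sum_(e | column_le e (s, j)) f e = \sum_(i < n | (i <= s)%N) f (i, j).
  transitivity (\sum_(i < n | (i <= s)%N) \sum_(k | k == j) f (i, k)).
    by rewrite pair_big; apply: eq_big => [e|[]] //; rewrite andbC.
  by apply: eq_bigr => i _; rewrite big_pred1_eq.
pose x (e : 'I_n * 'I_n) := A e.1 e.2.
have [|y [y_int row_y y_bounds]] := @exists_integral_rounding _ _ x.
  by move=> i; rewrite row_sum A_row mxE intr_int.
exists (\matrix_(i, j) y (i, j)); split; last by move=> i j; rewrite mxE.
split=> [i j|i|s j].
- have [le_y _] := y_bounds (inl (i, j)) 0.
  have [_ ge_y] := y_bounds (inl (i, j)) 1.
  have /andP[A0 A1] := A01 i j.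
  by rewrite /= !big_pred1_eq in le_y ge_y; rewrite mxE le_y ?ge_y.
- rewrite -A_row -(row_sum x) -row_y row_sum.
  by apply: eq_bigr => j _; rewrite mxE.
(* The lower bound in (C) is a cardinality, hence an integer that rounding does not cross. *)
have [le_y _] := y_bounds (inr (s, j))
  #|[set i : 'I_n | ((i, j) \in D) && (i <= s)%N]%SET|.
under eq_bigr do rewrite mxE.
rewrite /= !column_sum in le_y; exact/le_y/A_prefix.
Qed.
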